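(* Let $(M^3,g)$ be a $3$-dimensional Riemannian manifold such that for any $(p,v)\in SM$ there exists a (possibly short time) solution $u=u(t)\in\mathrm{End}(T_{\gamma(t)}M)$ of $u'(t)+u^2(t)+\mathrm{J}(t)=0$ along the geodesic $\gamma$ with $\gamma(0)=p$, $\gamma'(0)=v$, satisfying $u(t)\in \mathrm{Sym}^2_0(T_{\gamma(t)}M)$ and $u(t)\gamma'(t)=0$. Then $$\mathrm{P}^2=\mathrm{D}\left(-\mathrm{D}_1^2-4\,\mathrm{tr}(\mathring{\mathrm{J}}\circ\mathring{\mathrm{J}})\,\mathrm{ric}(X,X)\right)$$ for all $X\in TM$, where the homogeneous polynomial $\mathrm{P}$ in $X$, with $\deg \mathrm{P}\leq 8$, is given by $$\mathrm{P}:=\mathrm{tr}(\mathring{\mathrm{J}}\circ\mathring{\mathrm{J}})\,\mathrm{D}_2-\mathrm{tr}(\mathring{\mathrm{J}}\circ\mathring{\mathrm{J}}')\,\mathrm{D}_1 ,$$ and all of $\mathring{\mathrm{J}},\mathring{\mathrm{J}}',\mathrm{D},\mathrm{D}_1,\mathrm{D}_2$ are evaluated at $X$.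
   Context: $SM$ is the unit sphere bundle, $\nabla$ the Levi-Civita connection, $R(X,Y)=\nabla^2_{X,Y}-\nabla^2_{Y,X}$, $\mathrm{J}(X)=R(\cdot,X)X$ is the Jacobi operator, $\mathrm{J}(t)=\mathrm{J}(\gamma'(t))$, and $\mathrm{ric}$ is the Ricci form, so that $\mathrm{tr}\,\mathrm{J}(X)=\mathrm{ric}(X,X)$. $\mathrm{Sym}^2_0(TM)$ is the bundle of $g$-symmetric, trace-free endomorphisms; $u'=\nabla_{\gamma'}u$; ''short time'' means defined on some interval $(-\varepsilon,\varepsilon)$. For $X\in TM$ put $\mathrm{J}'(X)=(\nabla_XR)(\cdot,X)X$. Regarding $\mathrm{J}(X),\mathrm{J}'(X)$ as symmetric endomorphisms of $X^\perp$, let $\mathring{\mathrm{J}}(X)=\mathrm{J}(X)-\frac12\mathrm{tr}(\mathrm{J}(X))\,\mathrm{id}_{X^\perp}$ and $\mathring{\mathrm{J}}'(X)=\mathrm{J}'(X)-\frac12\mathrm{tr}(\mathrm{J}'(X))\,\mathrm{id}_{X^\perp}$ be their trace-free parts. Define $$\mathrm{D}_2:=2\,\mathrm{tr}(\mathrm{J}(X)\circ\mathrm{J}(X))-(\mathrm{ric}(X,X))^2+(\nabla^2_{X,X}\mathrm{ric})(X,X)=2\,\mathrm{tr}(\mathring{\mathrm{J}}(X)\circ\mathring{\mathrm{J}}(X))+(\nabla^2_{X,X}\mathrm{ric})(X,X),$$ $$\mathrm{D}_1:=(\nabla_X\mathrm{ric})(X,X),\qquad \mathrm{D}:=\det\left(\mathring{\mathrm{J}}(X)\circ\mathring{\mathrm{J}}'(X)-\mathring{\mathrm{J}}'(X)\circ\mathring{\mathrm{J}}(X)\right)$$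 (determinant on $X^\perp$). All expressions are zero for $X=0$. *)

(* Defs.v *)
From HB Require Import structures.
From mathcomp Require Import all_boot all_order all_algebra.
From mathcomp Require Import boolp classical_sets functions cardinality reals.
From mathcomp Require Import topology normedtype derive.
(* The notations of mpoly clash with those of the analysis library. *)
From mathcomp Require Import -(notations) mpoly.

Set Implicit Arguments.
Unset Strict Implicit.
Unset Printing Implicit Defensive.

Import Order.TTheory GRing.Theory Num.Theory.
Import numFieldNormedType.Exports.

Local Open Scope classical_set_scope.
Local Open Scope ring_scope.

(* Conventions.  Tangent vectors are given by their coordinates in a chart, as
   ROW vectors v = \sum_k v_k d_k, where d_k is the k-th coordinate field.  An
   endomorphism A acts by v |-> v *m A, so that row k of its matrix is A(d_k);
   a bilinear form h is the matrix of the h(d_j, d_k). *)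

Section EuclideanCalculus.
Context {R : realType} {n : nat}.

Definition partial {W : normedModType R} (k : 'I_n) (f : 'rV[R]_n -> W) :
    'rV[R]_n -> W :=
  fun x => 'D_(delta_mx 0 k) f x.

(* On an open set U this is C^oo: an iterated partial derivative which is
   differentiable is continuous. *)
Definition smooth_on {W : normedModType R} (U : set 'rV[R]_n)
    (f : 'rV[R]_n -> W) : Prop :=
  forall (s : seq 'I_n) (x : 'rV[R]_n), U x ->
    differentiable (foldr partial f s) x.

Definition bilin (h : 'M[R]_n) (v w : 'rV[R]_n) : R := (v *m h *m w^T) 0 0.

Definition endo_comp {k : nat} (A B : 'M[R]_k) : 'M[R]_k := B *m A.

Definition homogeneous_polynomial (d : nat) (f : 'rV[R]_n -> R) : Prop :=
  exists q : mpoly n R,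
    q \is ishomog1 d mdeg /\
    forall X : 'rV[R]_n, f X = meval (fun i => X 0 i) q.

End EuclideanCalculus.

(* A smooth manifold without boundary, with a smooth atlas indexed by
   [chart_index], and a smooth Riemannian metric given by its matrix in each
   chart.  [param i] is the inverse of the chart [chart i] and is only
   meaningful on the image of the latter. *)
Record riemannian_manifold (R : realType) (n : nat) := RiemannianManifold {
  points :> topologicalType;
  points_hausdorff : hausdorff_space points;
  points_second_countable : @second_countable points;
  chart_index : Type;
  dom : chart_index -> set points;
  chart : chart_index -> points -> 'rV[R]_n;
  param : chart_index -> 'rV[R]_n -> points;
  metric : chart_index -> 'rV[R]_n -> 'M[R]_n;
  dom_cover : forall p, exists i, dom i p;
  dom_open : forall i, open (dom i);
  img_open : forall i, open (chart i @` dom i);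
  chartK : forall i p, dom i p -> param i (chart i p) = p;
  chart_continuous : forall i, {within dom i, continuous (chart i)};
  param_continuous : forall i, {within chart i @` dom i, continuous (param i)};
  transition_smooth : forall i j,
    smooth_on (chart i @` (dom i `&` dom j)) (chart j \o param i);
  metric_smooth : forall i, smooth_on (chart i @` dom i) (metric i);
  metric_sym : forall i p, dom i p ->
    (metric i (chart i p))^T = metric i (chart i p);
  metric_pos : forall i p (v : 'rV[R]_n), dom i p -> v != 0 ->
    0 < bilin (metric i (chart i p)) v v;
  metric_transition : forall i j p, dom i p -> dom j p ->
    let A := jacobian (chart j \o param i) (chart i p) in
    metric i (chart i p) = A *m metric j (chart j p) *m A^T
}.

(* Levi-Civita calculus of the metric g in a coordinate domain of R^n. *)
Section LocalGeometry.
Context {R : realType} {n : nat}.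
Variable g : 'rV[R]_n -> 'M[R]_n.
Implicit Types (x X v : 'rV[R]_n) (i j k l m a : 'I_n).

(* christoffel i x is the endomorphism d_j |-> nabla_{d_i} d_j, that is, its
   (j, k) entry is Gamma_{ij}^k. *)
Definition christoffel i x : 'M[R]_n :=
  \matrix_(j, k) (2^-1 * \sum_l invmx (g x) k l *
    (partial i g x j l + partial j g x i l - partial l g x i j)).

Definition connection x v : 'M[R]_n := \sum_i v 0 i *: christoffel i x.

(* hess_endo i j x is the endomorphism d_k |-> nabla^2_{d_i, d_j} d_k. *)
Definition hess_endo i j x : 'M[R]_n :=
  partial i (christoffel j) x + christoffel j x *m christoffel i x
  - \sum_a christoffel i x j a *: christoffel a x.

(* curv i j x is the endomorphism R(d_i, d_j). *)
Definition curv i j x : 'M[R]_n := hess_endo i j x - hess_endo j i x.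

(* nabla_curv m i j x is the endomorphism (nabla_{d_m} R)(d_i, d_j). *)
Definition nabla_curv m i j x : 'M[R]_n :=
  partial m (curv i j) x
  + curv i j x *m christoffel m x - christoffel m x *m curv i j x
  - \sum_a christoffel m x i a *: curv a j x
  - \sum_a christoffel m x j a *: curv i a x.

(* The Jacobi operator Y |-> R(Y, X) X. *)
Definition jacobi x X : 'M[R]_n :=
  \matrix_(k, l) \sum_j X 0 j * (X *m curv k j x) 0 l.

(* Y |-> (nabla_X R)(Y, X) X *)
Definition jacobi' x X : 'M[R]_n :=
  \matrix_(k, l) \sum_m \sum_j
    X 0 m * X 0 j * (X *m nabla_curv m k j x) 0 l.

(* ric(Y, Z) is the trace of W |-> R(W, Y) Z. *)
Definition ricci x : 'M[R]_n :=
  \matrix_(j, k) \sum_i curv i j x k i.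

Definition nabla_ricci m x : 'M[R]_n :=
  partial m ricci x
  - christoffel m x *m ricci x - ricci x *m (christoffel m x)^T.

(* nabla2_ricci m k x is the bilinear form nabla^2_{d_m, d_k} ric. *)
Definition nabla2_ricci m k x : 'M[R]_n :=
  partial m (nabla_ricci k) x
  - christoffel m x *m nabla_ricci k x
  - nabla_ricci k x *m (christoffel m x)^T
  - \sum_a christoffel m x k a *: nabla_ricci a x.

(* The rows of perp x X span the g-orthogonal complement of X. *)
Definition perp x X : 'M[R]_n := kermx (g x *m X^T).

Definition tracefree_perp x X (A : 'M[R]_n) : 'M[R]_(\rank (perp x X)) :=
  let B := conjmx (row_base (perp x X)) A in B - (2^-1 * \tr B)%:M.

Definition Jo x X := tracefree_perp x X (jacobi x X).

Definition Jo' x X := tracefree_perp x X (jacobi' x X).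

Definition D1 x X : R :=
  \sum_m X 0 m * bilin (nabla_ricci m x) X X.

Definition D2 x X : R :=
  2 * \tr (endo_comp (jacobi x X) (jacobi x X)) - bilin (ricci x) X X ^+ 2
  + \sum_m \sum_k X 0 m * X 0 k * bilin (nabla2_ricci m k x) X X.

Definition DD x X : R :=
  \det (endo_comp (Jo x X) (Jo' x X) - endo_comp (Jo' x X) (Jo x X)).

Definition PP x X : R :=
  \tr (endo_comp (Jo x X) (Jo x X)) * D2 x X
  - \tr (endo_comp (Jo x X) (Jo' x X)) * D1 x X.

End LocalGeometry.

Section AlongCurves.
Context {R : realType} {n : nat} (M : riemannian_manifold R n).
Implicit Types (gamma : R -> M) (u : chart_index M -> R -> 'M[R]_n).

Definition curve_coord gamma (i : chart_index M) : R -> 'rV[R]_n :=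
  fun t => chart i (gamma t).

Definition velocity gamma (i : chart_index M) : R -> 'rV[R]_n :=
  derive1 (curve_coord gamma i).

Definition geodesic (eps : R) gamma : Prop :=
  forall t, - eps < t < eps ->
    {for t, continuous gamma} /\
    forall i, dom i (gamma t) ->
      let x := curve_coord gamma i t in
      let v := velocity gamma i in
      [/\ derivable (curve_coord gamma i) t 1, derivable v t 1 &
          derive1 v t + v t *m connection (metric i) x (v t) = 0].

(* A section of End(TM) along gamma: [u i t] is its matrix in the chart i,
   meaningful when gamma t is in the domain of i. *)
Definition endo_along (eps : R) gamma u : Prop :=
  forall t, - eps < t < eps -> forall i j,
    dom i (gamma t) -> dom j (gamma t) ->
    let A := jacobian (chart j \o param i) (curve_coord gamma i t) in
    u i t *m A = A *m u j t.

(* nabla_{gamma'} u in the chart i *)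
Definition cov_deriv gamma u (i : chart_index M) (t : R) : 'M[R]_n :=
  let G := connection (metric i) (curve_coord gamma i t) (velocity gamma i t) in
  derive1 (u i) t + u i t *m G - G *m u i t.

Definition riccati_solution (eps : R) gamma u : Prop :=
  endo_along eps gamma u /\
  forall t, - eps < t < eps -> forall i, dom i (gamma t) ->
    derivable (u i) t 1 /\
    cov_deriv gamma u i t + endo_comp (u i t) (u i t)
      + jacobi (metric i) (curve_coord gamma i t) (velocity gamma i t) = 0.

Definition sym_tracefree (h A : 'M[R]_n) : Prop :=
  (forall v w, bilin h (v *m A) w = bilin h v (w *m A)) /\ \tr A = 0.

(* The unit vector is given by its coordinates v in any chart i around p. *)
Definition has_tracefree_riccati_solutions : Prop :=
  forall (p : M) (i : chart_index M) (v : 'rV[R]_n),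
    dom i p -> bilin (metric i (chart i p)) v v = 1 ->
    exists (eps : R) (gamma : R -> M) (u : chart_index M -> R -> 'M[R]_n),
      [/\ 0 < eps, geodesic eps gamma, gamma 0 = p, velocity gamma i 0 = v &
          riccati_solution eps gamma u /\
          forall t, - eps < t < eps -> forall j, dom j (gamma t) ->
            sym_tracefree (metric j (curve_coord gamma j t)) (u j t) /\
            velocity gamma j t *m u j t = 0].

End AlongCurves.

(* Main.v *)
Require Import Defs.
From mathcomp Require Import all_boot all_order all_algebra.
From mathcomp Require Import boolp classical_sets functions.
From mathcomp Require Import reals topology normedtype landau derive.
From mathcomp Require Import -(notations) mpoly.
From mathcomp Require Import ring.

(** Let u be the trace-free symmetric solution of u' + u^2 + J = 0 along the
    geodesic of a unit vector X, with u X = 0.  On the plane orthogonal to the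
    geodesic u^2 is the scalar tr(u^2)/2, so that the trace and the trace-free
    part of the equation are tr(u^2) = - ric(X,X) and u' = - J0, where J0 is the
    trace-free part of J.  Differentiating the first equation twice and using
    the second one gives, for the inner product <A, B> = tr(AB),
      <u, u> = - ric,   2 <u, J0> = D1,   2 <u, J0'> = D2
    ([unit_riccati_algebra]).  The trace-free symmetric endomorphisms of a plane
    form a 2-dimensional space, hence the Gram determinant of u, J0, J0'
    vanishes.  Since D is the Gram determinant of J0 and J0', and P is twice the
    product of u with the vector <J0, J0> J0' - <J0, J0'> J0 orthogonal to J0,
    this is the asserted identity up to the factor 4 <J0, J0>
    ([gram_square], [restricted_gram_square]).

    The symmetry of J and J', which puts their images into the orthogonal
    complement of X, is read off from the Riccati equation: u is self-adjoint, so
    its covariant derivative is, hence so is J = - u' - u^2, and J' as the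
    covariant derivative of J ([cov_derive_selfadjoint], [cov_derive_jacobi]).
    The case of general X follows by scaling, X = 0 being trivial.

    For the polynomial part, traces of products of trace-free parts are
    polynomials in traces over the whole tangent space ([mxtrace_tracefree_conjmx]),
    and these are homogeneous polynomials in X ([homogeneous_PP_poly]). *)

Set Implicit Arguments.
Unset Strict Implicit.
Unset Printing Implicit Defensive.

Import Order.TTheory GRing.Theory Num.Theory.
Import numFieldNormedType.Exports.

Local Open Scope classical_set_scope.
Local Open Scope ring_scope.

(** * Trace-free endomorphisms of a plane *)

Section PlaneEndomorphisms.
Context {F : realFieldType}.
Implicit Types (A B C h : 'M[F]_2).

Lemma mxtrace2 A : \tr A = A 0 0 + A 1 1.
Proof.
rewrite /mxtrace !big_ord_recl big_ord0 addr0; congr (_ + A _ _); exact: val_inj.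
Qed.

Lemma mulmx2 A B i j : (A *m B) i j = A i 0 * B 0 j + A i 1 * B 1 j.
Proof.
rewrite mxE !big_ord_recl big_ord0 addr0; congr (_ + A _ _ * B _ _); exact: val_inj.
Qed.

Lemma det2 A : \det A = A 0 0 * A 1 1 - A 0 1 * A 1 0.
Proof.
rewrite (expand_det_row _ 0) !big_ord_recl big_ord0 addr0 /cofactor !det_mx11 !mxE.
have E : lift 0 0 = 1 :> 'I_2 by exact: val_inj.
have E' : lift 1 0 = 0 :> 'I_2 by exact: val_inj.
by rewrite !E !E' /= expr0 expr1 mul1r mulN1r mulrN.
Qed.

Lemma tracefree2 A : \tr A = 0 -> A 1 1 = - A 0 0.
Proof. by rewrite mxtrace2 addrC => /eqP; rewrite addr_eq0 => /eqP. Qed.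

(** For trace-free 2 x 2 matrices A^2 = tr(A^2)/2 and AB + BA = tr(AB), so
    the determinant of the commutator is the Gram determinant of A and B for
    the trace form. *)
Lemma det_commutator_tracefree2 A B : \tr A = 0 -> \tr B = 0 ->
  \det (A *m B - B *m A) = \tr (A *m A) * \tr (B *m B) - \tr (A *m B) ^+ 2.
Proof.
move=> /tracefree2 a /tracefree2 b.
have E i j : (A *m B - B *m A) i j = (A *m B) i j - (B *m A) i j.
  by rewrite [LHS]mxE [X in _ + X]mxE.
by rewrite det2 !E !mxtrace2 !mulmx2 a b; ring.
Qed.

(** The trace-free endomorphisms of the plane that are self-adjoint for a
    given bilinear form h, such as the metric, form a 2-dimensional space: three of them are
    linearly dependent, so their Gram determinant for the trace form, here
    written out, vanishes. *)
Lemma gram_tracefree_selfadjoint2 h A B C : h 0 0 != 0 ->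
  [/\ \tr A = 0, \tr B = 0 & \tr C = 0] ->
  [/\ A *m h = h *m A^T, B *m h = h *m B^T & C *m h = h *m C^T] ->
  \tr (A *m A) * (\tr (B *m B) * \tr (C *m C) - \tr (B *m C) ^+ 2)
  = \tr (A *m B) ^+ 2 * \tr (C *m C)
    - 2 * \tr (A *m B) * \tr (A *m C) * \tr (B *m C)
    + \tr (A *m C) ^+ 2 * \tr (B *m B).
Proof.
move=> h0 [/tracefree2 a /tracefree2 b /tracefree2 c] [sA sB sC].
(* The entry (0, 1) of D h = h D^T expresses D 1 0 by the first row of D. *)
have off (D : 'M[F]_2) : D 1 1 = - D 0 0 -> D *m h = h *m D^T ->
    D 1 0 = (2 * D 0 0 * h 0 1 + D 0 1 * h 1 1) / h 0 0.
  move=> d /matrixP /(_ 0 1); rewrite !mulmx2 !mxE d => E.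
  apply: (mulIf h0); rewrite divfK // -[LHS](addrK (h 0 1 * - D 0 0)) [D 1 0 * _]mulrC -E.
  by ring.
move: (off _ a sA) (off _ b sB) (off _ c sC) => a' b' c'.
by rewrite !mxtrace2 !mulmx2 a b c a' b' c'; field.
Qed.

(** Expressing tr(u^2) = - r by the products of u with A and B in the
    vanishing Gram determinant of u, A, B, and multiplying by 4 tr(A^2),
    completes the square of the left-hand side. *)
Lemma gram_square h u A B r (d1 d2 : F) : h 0 0 != 0 ->
  [/\ \tr u = 0, \tr A = 0 & \tr B = 0] ->
  [/\ u *m h = h *m u^T, A *m h = h *m A^T & B *m h = h *m B^T] ->
  \tr (u *m u) = - r -> 2 * \tr (u *m A) = d1 -> 2 * \tr (u *m B) = d2 ->
  (\tr (A *m A) * d2 - \tr (A *m B) * d1) ^+ 2 =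
  \det (A *m B - B *m A) * (- d1 ^+ 2 - 4 * \tr (A *m A) * r).
Proof.
move=> h0 tr0 sa uu <- <-; have G := gram_tracefree_selfadjoint2 h0 tr0 sa.
case: tr0 => _ A0 B0; rewrite det_commutator_tracefree2 //.
move: G; rewrite uu; set JJ := \tr (A *m A); set JK := \tr (A *m B); set KK := \tr (B *m B).
set x := \tr _; set y := \tr _ => G; apply/subr0_eq.
rewrite [LHS](_ : _ = 4 * JJ * (x ^+ 2 * KK - 2 * x * y * JK + y ^+ 2 * JJ
   - - r * (JJ * KK - JK ^+ 2))); last by ring.
by rewrite -G subrr mulr0.
Qed.

End PlaneEndomorphisms.

Section Restriction.
Context {F : fieldType} {r n : nat}.
Implicit Types (V : 'M[F]_(r, n)) (A g : 'M[F]_n).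

(** The image of A lies in V, hence only V contributes to the trace. *)
Lemma mxtrace_conjmx V A : (A <= V)%MS -> \tr (conjmx V A) = \tr A.
Proof. by move=> AV; rewrite /conjmx -mulmxA mxtrace_mulC mulmxKpV. Qed.

Lemma conjmx_stable V A : stablemx V A -> conjmx V A *m V = V *m A.
Proof. by move=> VA; rewrite /conjmx mulmxKpV. Qed.

Lemma conjmx_selfadjoint V A g : stablemx V A ->
  A *m g = g *m A^T ->
  conjmx V A *m (V *m g *m V^T) = V *m g *m V^T *m (conjmx V A)^T.
Proof.
move=> VA Ag; rewrite -[RHS]mulmxA -trmx_mul !mulmxA conjmx_stable //.
by rewrite trmx_mul -!mulmxA; congr (_ *m _); rewrite !mulmxA Ag.
Qed.

End Restriction.

Section Perp.
Context {R : realType} {n : nat}.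
Variables (g : 'M[R]_n) (X : 'rV[R]_n).
Hypotheses (gs : g^T = g) (gp : forall v : 'rV[R]_n, v != 0 -> 0 < bilin g v v).

Lemma rank_perp : X != 0 -> \rank (kermx (g *m X^T)) = n.-1.
Proof.
move=> X0; rewrite mxrank_ker.
suff -> : \rank (g *m X^T) = 1%N by rewrite subn1.
rewrite -mxrank_tr rank_rV trmx_mul trmxK gs; case: eqP => // E.
by move: (gp X0); rewrite /bilin E mul0mx mxE ltxx.
Qed.

(** A self-adjoint endomorphism maps into the orthogonal complement of its
    kernel. *)
Lemma selfadjoint_sub_perp A : A *m g = g *m A^T -> X *m A = 0 ->
  (A <= row_base (kermx (g *m X^T)))%MS.
Proof.
move=> Ag XA; rewrite eq_row_base; apply/sub_kermxP.
by rewrite mulmxA Ag -mulmxA -trmx_mul XA trmx0 mulmx0.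
Qed.

End Perp.

(** For r = 2 the trace-free part of the restriction of A to V; with V a basis
    of the orthogonal complement of X this is [tracefree_perp]. *)
Definition tracefree_conjmx (F : fieldType) (r n : nat) (V : 'M[F]_(r, n)) (A : 'M[F]_n) :=
  conjmx V A - (2^-1 * \tr (conjmx V A))%:M.

(** The algebraic core, on a plane V containing the images of u, A and B:
    replacing A and B by the trace-free parts of their restrictions does not
    change the products with u, which is itself trace-free. *)
Lemma restricted_gram_square (F : realFieldType) (r n : nat) (V : 'M[F]_(r, n))
  (g u A B : 'M[F]_n) (d1 d2 : F) :
  r = 2%N -> row_free V ->
  (forall v : 'rV[F]_n, v != 0 -> (v *m g *m v^T) 0 0 != 0) ->
  [/\ u *m g = g *m u^T, A *m g = g *m A^T & B *m g = g *m B^T] ->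
  [/\ (u <= V)%MS, (A <= V)%MS & (B <= V)%MS] ->
  \tr u = 0 -> \tr (u *m u) = - \tr A ->
  2 * \tr (u *m A) = d1 -> 2 * \tr (u *m B) = d2 ->
  let A0 := tracefree_conjmx V A in let B0 := tracefree_conjmx V B in
  (\tr (A0 *m A0) * d2 - \tr (B0 *m A0) * d1) ^+ 2 =
  \det (B0 *m A0 - A0 *m B0) * (- d1 ^+ 2 - 4 * \tr (A0 *m A0) * \tr A).
Proof.
move=> r2; subst r => Vf gp [su sA sB] [uV AV BV] u0 uu uA uB A0 B0.
have trM C D : (C <= V)%MS -> (D <= V)%MS -> \tr (conjmx V C *m conjmx V D) = \tr (C *m D).
  by move=> CV DV; rewrite -conjmxM ?inE ?mulmx_sub // mxtrace_conjmx // mulmx_sub.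
have tf C : \tr (tracefree_conjmx V C) = 0.
  rewrite /tracefree_conjmx linearB /= mxtrace_scalar -[X in _ - X]mulr_natr.
  by rewrite mulrAC mulVf ?pnatr_eq0 // mul1r subrr.
have ru : tracefree_conjmx V u = conjmx V u.
  by rewrite /tracefree_conjmx mxtrace_conjmx // u0 mulr0 raddf0 subr0.
have sa C : (C <= V)%MS -> C *m g = g *m C^T ->
    tracefree_conjmx V C *m (V *m g *m V^T) = V *m g *m V^T *m (tracefree_conjmx V C)^T.
  move=> CV Cg; rewrite /tracefree_conjmx mulmxBl linearB /= mulmxBr.
  rewrite conjmx_selfadjoint ?mulmx_sub //.
  by rewrite tr_scalar_mx scalar_mxC.
have uC C : (C <= V)%MS -> \tr (tracefree_conjmx V u *m tracefree_conjmx V C) = \tr (u *m C).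
  move=> CV; rewrite ru /tracefree_conjmx mulmxBr linearB /= trM //.
  by rewrite mul_mx_scalar linearZ /= (mxtrace_conjmx uV) u0 mulr0 subr0.
rewrite [B0 *m A0 - _](_ : _ = - (A0 *m B0 - B0 *m A0)); last by rewrite opprB.
rewrite -[- (A0 *m B0 - _)]scaleN1r detZ sqrrN expr1n mul1r (mxtrace_mulC B0 A0).
apply: (@gram_square _ (V *m g *m V^T) (tracefree_conjmx V u) A0 B0).
- have E : (V *m g *m V^T) 0 0 = (row 0 V *m g *m (row 0 V)^T) 0 0.
    by rewrite -row_mul !mxE; apply: eq_bigr => k _; rewrite !mxE.
  rewrite E; apply: gp; apply/negP => /eqP V0.
  have /row_freeP [W VW] := Vf; have := congr1 (row 0) VW.
  rewrite row_mul V0 mul0mx => /rowP /(_ 0); rewrite !mxE eqxx => /eqP.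
  by rewrite eq_sym oner_eq0.
- by split; exact: tf.
- by split; exact: sa.
- by rewrite {2}ru -ru uC.
- by rewrite uC.
- by rewrite uC.
Qed.

(** Cayley-Hamilton in dimension 2. *)
Lemma square_tracefree2 (F : realFieldType) (A : 'M[F]_2) : \tr A = 0 ->
  A *m A = (2^-1 * \tr (A *m A))%:M.
Proof.
move=> /tracefree2 a; apply/matrixP => i j; rewrite [RHS]mxE mxtrace2 !mulmx2 a.
have ord2 (k : 'I_2) : k = 0 \/ k = 1.
  by case: k => [[|[|//]] ?]; [left|right]; exact: val_inj.
by case: (ord2 i) => ->; case: (ord2 j) => -> /=; rewrite ?a ?mulr1n ?mulr0n; field.
Qed.

(** On the plane V the square of the trace-free u is the scalar tr(u^2)/2. *)
Lemma mxtrace_square_mul (F : realFieldType) (r n : nat) (V : 'M[F]_(r, n)) (u A : 'M[F]_n) :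
  r = 2%N -> row_free V -> (u <= V)%MS -> (A <= V)%MS -> \tr u = 0 ->
  \tr (u *m u *m A) = 2^-1 * \tr (u *m u) * \tr A.
Proof.
move=> r2 Vf uV AV u0; subst r.
have uuV : (u *m u <= V)%MS by exact: mulmx_sub.
rewrite -(mxtrace_conjmx (mulmx_sub (u *m u) AV)) -(mxtrace_conjmx uuV) -(mxtrace_conjmx AV).
rewrite !conjmxM ?inE ?mulmx_sub // square_tracefree2 ?mxtrace_conjmx //.
rewrite mul_scalar_mx mxtraceZ mxtrace_scalar (mxtrace_conjmx AV).
by rewrite -[_ *+ 2]mulr_natr; field.
Qed.

Lemma mxtrace_tracefree_conjmx (F : realFieldType) (r n : nat) (V : 'M[F]_(r, n))
    (A B : 'M[F]_n) :
  r = 2%N -> row_free V -> (A <= V)%MS -> (B <= V)%MS ->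
  \tr (tracefree_conjmx V A *m tracefree_conjmx V B) = \tr (A *m B) - 2^-1 * \tr A * \tr B.
Proof.
move=> r2 Vf AV BV; subst r.
rewrite /tracefree_conjmx mulmxBl !mulmxBr -conjmxM ?inE ?mulmx_sub // !raddfB /=.
rewrite !mul_mx_scalar !mul_scalar_mx !mxtraceZ !mxtrace_scalar.
rewrite !mxtrace_conjmx // ?mulmx_sub //.
by field.
Qed.

(** * Derivatives of matrices and the chain rule *)

Section MatrixCalculus.
Context {R : realType} {V : normedModType R} (x v : V).

Lemma is_derive_mx m n (A : V -> 'M[R]_(m, n)) dA :
  is_derive x v A dA <-> forall i j, is_derive x v (fun y => A y i j) (dA i j).
Proof.
split=> [[dvA <-] i j|H].
  rewrite derive_mx // mxE; apply: DeriveDef => //.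
  by have /derivable_mxP := dvA; apply.
have dvA : derivable A x v by apply/derivable_mxP => i j; have [] := H i j.
apply: DeriveDef => //; rewrite derive_mx //; apply/matrixP => i j.
by rewrite mxE; have [] := H i j.
Qed.

Lemma is_derive_sumf n (f : 'I_n -> V -> R) (df : 'I_n -> R) :
  (forall i, is_derive x v (f i) (df i)) ->
  is_derive x v (fun y => \sum_i f i y) (\sum_i df i).
Proof.
move=> H; rewrite (_ : (fun _ => _) = \sum_i f i); first exact: is_derive_sum.
by apply/funext => y; rewrite fct_sumE.
Qed.

Lemma is_derive_mulf (f g : V -> R) df dg :
  is_derive x v f df -> is_derive x v g dg ->
  is_derive x v (fun y => f y * g y) (df * g x + f x * dg).
Proof.
by move=> Hf Hg; apply: is_derive_eq; rewrite /GRing.scale /= addrC [g x * _]mulrC.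
Qed.

Lemma is_derive_mulmx m n p (A : V -> 'M[R]_(m, n)) (B : V -> 'M[R]_(n, p)) dA dB :
  is_derive x v A dA -> is_derive x v B dB ->
  is_derive x v (fun y => A y *m B y) (dA *m B x + A x *m dB).
Proof.
move=> /is_derive_mx HA /is_derive_mx HB; apply/is_derive_mx => i j.
rewrite (_ : (fun _ => _) = fun y => \sum_k A y i k * B y k j); last first.
  by apply/funext => y; rewrite mxE.
rewrite !mxE -big_split /=; apply: is_derive_sumf => k; exact: is_derive_mulf.
Qed.

Lemma is_derive_scalemx m n (f : V -> R) (A : V -> 'M[R]_(m, n)) df dA :
  is_derive x v f df -> is_derive x v A dA ->
  is_derive x v (fun y => f y *: A y) (df *: A x + f x *: dA).
Proof.
move=> Hf /is_derive_mx HA; apply/is_derive_mx => i j.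
rewrite (_ : (fun _ => _) = fun y => f y * A y i j); last first.
  by apply/funext => y; rewrite mxE.
by rewrite !mxE; exact: is_derive_mulf.
Qed.

Lemma is_derive_trmx m n (A : V -> 'M[R]_(m, n)) dA :
  is_derive x v A dA -> is_derive x v (fun y => (A y)^T) dA^T.
Proof.
move=> /is_derive_mx HA; apply/is_derive_mx => i j.
rewrite (_ : (fun _ => _) = fun y => A y j i) ?mxE //.
by apply/funext => y; rewrite mxE.
Qed.

Lemma is_derive_mxtrace n (A : V -> 'M[R]_n) dA :
  is_derive x v A dA -> is_derive x v (fun y => \tr (A y)) (\tr dA).
Proof. by move=> /is_derive_mx HA; apply: is_derive_sumf. Qed.

Lemma is_derive_summx k m n (A : 'I_k -> V -> 'M[R]_(m, n)) dA :
  (forall i, is_derive x v (A i) (dA i)) ->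
  is_derive x v (fun y => \sum_i A i y) (\sum_i dA i).
Proof.
move=> H; rewrite (_ : (fun _ => _) = \sum_i A i); first exact: is_derive_sum.
by apply/funext => y; rewrite fct_sumE.
Qed.

End MatrixCalculus.

Lemma is_derive_unique (R : realType) (V W : normedModType R) (f : V -> W) x v a b :
  is_derive x v f a -> is_derive x v f b -> a = b.
Proof. by move=> [_ <-] [_ <-]. Qed.

Section ChainRule.
Context {R : realType} {n : nat} {W : normedModType R}.

Lemma derive_partial (f : 'rV[R]_n -> W) x w : differentiable f x ->
  'D_w f x = \sum_k w 0 k *: partial k f x.
Proof.
move=> df; rewrite deriveE // {1}(row_sum_delta w) linear_sum.
by apply: eq_bigr => k _; rewrite linearZ /partial deriveE.
Qed.

Lemma is_derive_along (f : 'rV[R]_n -> W) (c : R -> 'rV[R]_n) t w :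
  differentiable f (c t) -> is_derive t 1 c w ->
  is_derive t 1 (fun s => f (c s)) (\sum_k w 0 k *: partial k f (c t)).
Proof.
move=> df [dc <-]; have dc' : differentiable c t by apply/derivable1_diffP.
rewrite -derive_partial //.
have dfc : differentiable (f \o c) t by exact: differentiable_comp.
apply: DeriveDef; first exact/derivable1_diffP.
by rewrite [LHS]deriveE // diff_comp //= deriveE // deriveE.
Qed.

End ChainRule.

(** * Regularity of the curvature *)

(** The product and inverse rules for derivatives, and the symmetry of the
    metric, only hold on an open set: derivatives of these identities are taken
    locally. *)
Lemma near_eq_differentiable (R : numFieldType) (V W : normedModType R) (f g : V -> W) x :
  {near x, f =1 g} -> differentiable f x -> differentiable g x.
Proof.
move=> fg df.
have E : g \o shift x = cst (g x) + 'd f x +o_ 0 id.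
  apply/eqaddoP => e e0.
  have /eqaddoP /(_ e e0) := diff_locally df; rewrite (nbhs_singleton fg).
  apply: filter_app; near=> h.
  suff E : f (h + x) = g (h + x) by rewrite !fctE /= E.
  near: h; have := fg; rewrite (near_shift 0 x)/=.
  apply: filter_app; near=> h; by rewrite /= subr0.
have dE : 'd g x = 'd f x :> (V -> W) by apply: diff_unique => //; exact: diff_continuous.
by apply/diff_locallyP; rewrite dE; split=> //; exact: diff_continuous.
Unshelve. all: by end_near. Qed.

Section FiniteDifferentiability.
Context {R : realType} {n : nat} (U : set 'rV[R]_n) (Uopen : open U).

Section FiniteOrder.
Context {W : normedModType R}.

(** Differentiability of the iterated partial derivatives up to order k.
    Unlike [smooth_on], this splits off one derivative at a time, so that
    stability under the inverse is an induction on k: the derivative of 1 / f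
    only involves 1 / f and the derivative of f. *)
Fixpoint diffn_on (k : nat) (f : 'rV[R]_n -> W) : Prop :=
  (forall x, U x -> differentiable f x) /\
  if k is l.+1 then forall i, diffn_on l (partial i f) else True.

End FiniteOrder.

Lemma diffn_on_differentiable {W : normedModType R} k (f : 'rV[R]_n -> W) x :
  diffn_on k f -> U x -> differentiable f x.
Proof. by case: k => [|k] [df _]; exact: df. Qed.

Lemma smooth_diffn_on {W : normedModType R} k (f : 'rV[R]_n -> W) :
  smooth_on U f -> diffn_on k f.
Proof.
elim: k f => [|k IH] f sf; split=> //; try exact: (sf [::]).
by move=> i; apply: IH => s x Ux; have := sf (rcons s i) x Ux; rewrite foldr_rcons.
Qed.

Lemma diffn_onW {W : normedModType R} k (f : 'rV[R]_n -> W) :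
  diffn_on k.+1 f -> diffn_on k f.
Proof. by elim: k f => [|k IH] f [df dpf]; split=> // i; exact: IH. Qed.

Lemma eq_in_near {W : Type} (f g : 'rV[R]_n -> W) x :
  U x -> {in U, f =1 g} -> {near x, f =1 g}.
Proof.
move=> Ux fg; near=> y; apply: fg; apply: mem_set; near: y.
exact: open_nbhs_nbhs.
Unshelve. all: by end_near. Qed.

Lemma partial_eq {W : normedModType R} (f g : 'rV[R]_n -> W) i :
  {in U, f =1 g} -> {in U, partial i f =1 partial i g}.
Proof.
by move=> fg x /set_mem Ux; apply: near_eq_derive; exact: eq_in_near.
Qed.

Lemma diffn_on_eq {W : normedModType R} k (f g : 'rV[R]_n -> W) :
  {in U, f =1 g} -> diffn_on k f -> diffn_on k g.
Proof.
elim: k f g => [|k IH] f g fg [df dpf]; split=> //.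
- move=> x Ux; apply: near_eq_differentiable (df _ Ux); exact: eq_in_near.
- move=> x Ux; apply: near_eq_differentiable (df _ Ux); exact: eq_in_near.
- by move=> i; apply: IH (dpf i); exact: partial_eq.
Qed.

Lemma diffn_on_cst {W : normedModType R} k (c : W) : diffn_on k (fun=> c).
Proof.
elim: k c => [|k IH] c; split=> //; try by move=> x _; exact: differentiable_cst.
by move=> i; apply: diffn_on_eq (IH 0) => x _; rewrite /partial derive_cst.
Qed.

Lemma diffn_onD {W : normedModType R} k (f g : 'rV[R]_n -> W) :
  diffn_on k f -> diffn_on k g -> diffn_on k (fun x => f x + g x).
Proof.
elim: k f g => [|k IH] f g [df pf] [dg pg]; split=> //;
  try by move=> x Ux; apply: differentiableD; [exact: df|exact: dg].
move=> i; apply: diffn_on_eq (IH _ _ (pf i) (pg i)) => x /set_mem Ux.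
by rewrite /partial deriveD //; apply: diff_derivable; [exact: df|exact: dg].
Qed.

Lemma diffn_onM k (f g : 'rV[R]_n -> R) :
  diffn_on k f -> diffn_on k g -> diffn_on k (fun x => f x * g x).
Proof.
elim: k f g => [|k IH] f g Cf Cg; have [df pf] := Cf; have [dg pg] := Cg; split=> //;
  try by move=> x Ux; apply: differentiableM; [exact: df|exact: dg].
move=> i.
apply: diffn_on_eq (diffn_onD (IH _ _ (pf i) (diffn_onW Cg)) (IH _ _ (diffn_onW Cf) (pg i))).
move=> x /set_mem Ux; apply/esym.
have [_ <- //] := is_derive_mulf (derivableP (diff_derivable (v := delta_mx 0 i) (df x Ux)))
   (derivableP (diff_derivable (v := delta_mx 0 i) (dg x Ux))).
Qed.

Lemma diffn_onZ k c (f : 'rV[R]_n -> R) :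
  diffn_on k f -> diffn_on k (fun x => c * f x).
Proof. by apply: diffn_onM; exact: diffn_on_cst. Qed.

Lemma diffn_onN k (f : 'rV[R]_n -> R) :
  diffn_on k f -> diffn_on k (fun x => - f x).
Proof.
move=> Cf; apply: diffn_on_eq (diffn_onZ (-1) Cf) => x _.
by rewrite mulN1r.
Qed.

Lemma diffn_onV k (f : 'rV[R]_n -> R) : (forall x, U x -> f x != 0) ->
  diffn_on k f -> diffn_on k (fun x => (f x)^-1).
Proof.
move=> f0; elim: k => [|k IH] Cf; have [df pf] := Cf; split=> //;
  try by move=> x Ux; apply: differentiableV; [exact: df|exact: f0].
move=> i; have CV := IH (diffn_onW Cf).
apply: diffn_on_eq (diffn_onN (diffn_onM (diffn_onM CV CV) (pf i))).
move=> x /set_mem Ux; rewrite /partial deriveV ?f0 //; last first.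
  exact: diff_derivable (df x Ux).
by rewrite -invfM -expr2 -mulNr.
Qed.

Lemma diffn_on_sum (I : Type) (r : seq I) (P : pred I) k (f : I -> 'rV[R]_n -> R) :
  (forall i, diffn_on k (f i)) -> diffn_on k (fun x => \sum_(i <- r | P i) f i x).
Proof.
move=> Cf; elim: r => [|i r IH].
  by apply: diffn_on_eq (diffn_on_cst k 0) => x _; rewrite big_nil.
case Pi : (P i).
  by have := diffn_onD (Cf i) IH; apply: diffn_on_eq => x _; rewrite big_cons Pi.
by apply: diffn_on_eq IH => x _; rewrite big_cons Pi.
Qed.

Lemma diffn_on_prod (I : Type) (r : seq I) (P : pred I) k (f : I -> 'rV[R]_n -> R) :
  (forall i, diffn_on k (f i)) -> diffn_on k (fun x => \prod_(i <- r | P i) f i x).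
Proof.
move=> Cf; elim: r => [|i r IH].
  by have := diffn_on_cst k (1 : R); apply: diffn_on_eq => x _; rewrite big_nil.
case Pi : (P i).
  by have := diffn_onM (Cf i) IH; apply: diffn_on_eq => x _; rewrite big_cons Pi.
by apply: diffn_on_eq IH => x _; rewrite big_cons Pi.
Qed.

Lemma partial_mx p q (A : 'rV[R]_n -> 'M[R]_(p, q)) k x i j : differentiable A x ->
  partial k A x i j = partial k (fun y => A y i j) x.
Proof.
by move=> dA; rewrite /partial derive_mx ?mxE //; exact: diff_derivable.
Qed.

Lemma differentiable_entry p q (A : 'rV[R]_n -> 'M[R]_(p, q)) x i j :
  differentiable A x -> differentiable (fun y => A y i j) x.
Proof.
move=> dA.
have := @differentiable_comp _ _ _ _ A (fun N : 'M[R]_(p, q) => N i j) x dA.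
by apply; exact: differentiable_coord.
Qed.

Lemma differentiable_mx p q (A : 'rV[R]_n -> 'M[R]_(p, q)) x :
  (forall i j, differentiable (fun y => A y i j) x) -> differentiable A x.
Proof.
move=> dA; rewrite (_ : A = \sum_i \sum_j fun y => A y i j *: delta_mx i j).
  by apply: differentiable_sum => i; apply: differentiable_sum => j; exact: differentiableZl.
apply/funext => y; rewrite {1}[A y]matrix_sum_delta fct_sumE.
by apply: eq_bigr => i _; rewrite fct_sumE.
Qed.

Lemma diffn_on_mx p q k (A : 'rV[R]_n -> 'M[R]_(p, q)) :
  diffn_on k A <-> forall i j, diffn_on k (fun x => A x i j).
Proof.
elim: k A => [|k IH] A; split.
- by move=> [dA _] i j; split=> // x /dA; exact: differentiable_entry.
- by move=> dA; split=> // x Ux; apply: differentiable_mx => i j; exact: (dA i j).1.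
- move=> [dA pA] i j; split=> [x /dA|l]; first exact: differentiable_entry.
  apply: diffn_on_eq ((IH _).1 (pA l) i j) => x /set_mem Ux.
  by rewrite partial_mx //; exact: dA.
- move=> dA.
  have dfA x : U x -> differentiable A x.
    by move=> Ux; apply: differentiable_mx => i j; exact: (dA i j).1.
  split=> // l; apply/IH => i j.
  apply: diffn_on_eq ((dA i j).2 l) => x /set_mem Ux.
  by rewrite partial_mx //; exact: dfA.
Qed.

Lemma diffn_on_mulmx p q r k (A : 'rV[R]_n -> 'M[R]_(p, q)) (B : 'rV[R]_n -> 'M[R]_(q, r)) :
  diffn_on k A -> diffn_on k B -> diffn_on k (fun x => A x *m B x).
Proof.
move=> /diffn_on_mx CA /diffn_on_mx CB; apply/diffn_on_mx => i j.
apply: diffn_on_eq (diffn_on_sum (index_enum _) xpredT (fun l => diffn_onM (CA i l) (CB l j))).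
by move=> x _; rewrite mxE.
Qed.

Lemma diffn_on_summx p q k (I : finType) (A : I -> 'rV[R]_n -> 'M[R]_(p, q)) :
  (forall l, diffn_on k (A l)) -> diffn_on k (fun x => \sum_l A l x).
Proof.
move=> CA; apply/diffn_on_mx => i j.
apply: diffn_on_eq (diffn_on_sum (index_enum _) xpredT
  (fun l => (diffn_on_mx _ _).1 (CA l) i j)).
by move=> x _; rewrite summxE.
Qed.

Lemma diffn_on_scalemx p q k (f : 'rV[R]_n -> R) (A : 'rV[R]_n -> 'M[R]_(p, q)) :
  diffn_on k f -> diffn_on k A -> diffn_on k (fun x => f x *: A x).
Proof.
move=> Cf /diffn_on_mx CA; apply/diffn_on_mx => i j.
by apply: diffn_on_eq (diffn_onM Cf (CA i j)) => x _; rewrite mxE.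
Qed.

Lemma diffn_on_oppmx p q k (A : 'rV[R]_n -> 'M[R]_(p, q)) :
  diffn_on k A -> diffn_on k (fun x => - A x).
Proof.
move=> /diffn_on_mx CA; apply/diffn_on_mx => i j.
by apply: diffn_on_eq (diffn_onN (CA i j)) => x _; rewrite mxE.
Qed.

Lemma diffn_on_trmx p q k (A : 'rV[R]_n -> 'M[R]_(p, q)) :
  diffn_on k A -> diffn_on k (fun x => (A x)^T).
Proof.
move=> /diffn_on_mx CA; apply/diffn_on_mx => i j.
by apply: diffn_on_eq (CA j i) => x _; rewrite mxE.
Qed.

Lemma diffn_on_det p k (A : 'rV[R]_n -> 'M[R]_p) :
  diffn_on k A -> diffn_on k (fun x => \det (A x)).
Proof.
move=> /diffn_on_mx CA; apply: diffn_on_sum => s; apply: diffn_onZ.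
exact: diffn_on_prod.
Qed.

(** By Cramer's rule. *)
Lemma diffn_on_invmx p k (A : 'rV[R]_n -> 'M[R]_p) :
  (forall x, U x -> A x \in unitmx) ->
  diffn_on k A -> diffn_on k (fun x => invmx (A x)).
Proof.
move=> uA CA; have /diffn_on_mx CAe := CA.
have Cadj : diffn_on k (fun x => \adj (A x)).
  apply/diffn_on_mx => i j.
  apply: (@diffn_on_eq _ _ (fun x => (-1) ^+ (j + i) * \det (row' j (col' i (A x))))).
    by move=> x _; rewrite mxE.
  apply: diffn_onZ; apply: diffn_on_det; apply/diffn_on_mx => a b.
  by apply: diffn_on_eq (CAe (lift j a) (lift i b)) => x _; rewrite !mxE.
apply: (@diffn_on_eq _ _ (fun x => (\det (A x))^-1 *: \adj (A x))).
  by move=> x /set_mem Ux; rewrite /invmx uA.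
apply: diffn_on_scalemx => //; apply: diffn_onV; last exact: diffn_on_det.
by move=> x /uA; rewrite unitmxE unitfE.
Qed.

End FiniteDifferentiability.

Section LocalRegularity.
Context {R : realType} {n : nat} (U : set 'rV[R]_n) (Uopen : open U).
Variables (g : 'rV[R]_n -> 'M[R]_n).
Hypotheses (gsm : smooth_on U g) (gu : forall x, U x -> g x \in unitmx).

Lemma diffn_on_christoffel k i : diffn_on U k (christoffel g i).
Proof.
have Cg : diffn_on U k.+1 g by exact: smooth_diffn_on.
have Ci : diffn_on U k (fun x => invmx (g x)).
  by apply: diffn_on_invmx => //; exact: diffn_onW.
have Cp a b c : diffn_on U k (fun x => partial a g x b c).
  by have /diffn_on_mx := Cg.2 a; apply.
apply/diffn_on_mx => // j l.
apply: (diffn_on_eq Uopen (f := fun x => 2^-1 * \sum_a invmx (g x) l a *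
  (partial i g x j a + partial j g x i a - partial a g x i j))).
  by move=> x _; rewrite mxE.
apply: diffn_onZ => //; apply: diffn_on_sum => // a; apply: diffn_onM => //.
  by have /diffn_on_mx := Ci; apply.
apply: diffn_onD => //; last exact: diffn_onN.
exact: diffn_onD.
Qed.

Lemma diffn_on_curv k i j : diffn_on U k (curv g i j).
Proof.
have Ch a b : diffn_on U k (hess_endo g a b).
  apply: diffn_onD => //.
    apply: diffn_onD => //; first exact: (diffn_on_christoffel k.+1 b).2.
    by apply: diffn_on_mulmx => //; exact: diffn_on_christoffel.
  apply: diffn_on_oppmx => //; apply: diffn_on_summx => // l.
  apply: diffn_on_scalemx => //; last exact: diffn_on_christoffel.
  by have /diffn_on_mx := diffn_on_christoffel k a; apply.
by apply: diffn_onD => //; exact: diffn_on_oppmx.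
Qed.

Lemma diffn_on_ricci k : diffn_on U k (ricci g).
Proof.
apply/diffn_on_mx => // j l.
apply: (diffn_on_eq Uopen (f := fun x => \sum_i curv g i j x l i)).
  by move=> x _; rewrite mxE.
apply: diffn_on_sum => // i.
by have /diffn_on_mx := diffn_on_curv k i j; apply.
Qed.

Lemma diffn_on_nabla_ricci k m : diffn_on U k (nabla_ricci g m).
Proof.
have Cc := diffn_on_christoffel k; have Cr := diffn_on_ricci.
apply: diffn_onD => //.
  apply: diffn_onD => //; first exact: (Cr k.+1).2.
  by apply: diffn_on_oppmx => //; exact: diffn_on_mulmx.
apply: diffn_on_oppmx => //; apply: diffn_on_mulmx => //; exact: diffn_on_trmx.
Qed.

End LocalRegularity.

(** * Covariant derivatives along a geodesic *)

Section PointwiseIdentities.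
Context {R : realType} {n : nat}.
Variable g : 'rV[R]_n -> 'M[R]_n.
Implicit Types (x w : 'rV[R]_n).

(** The metric is parallel: by the Koszul formula, lowering an index of the
    Christoffel symbols gives a combination of partial derivatives of g, whose
    symmetrization is the derivative of g. *)
Lemma partial_metric x k : g x \in unitmx -> (g x)^T = g x ->
  (forall l, (partial l g x)^T = partial l g x) ->
  partial k g x = christoffel g k x *m g x + g x *m (christoffel g k x)^T.
Proof.
move=> gu gs dgs.
have lower i : christoffel g i x *m g x = \matrix_(j, l) (2^-1 *
    (partial i g x j l + partial j g x i l - partial l g x i j)).
  rewrite -[RHS]mulmx1 -(mulVmx gu) mulmxA; congr (_ *m _).
  apply/matrixP => j l; rewrite !mxE mulr_sumr; apply: eq_bigr => m _.
  rewrite !mxE mulrCA mulrC; congr (_ * _).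
  by rewrite -[in LHS]gs -trmx_inv mxE.
rewrite -{2}gs -trmx_mul lower; apply/matrixP => j l; rewrite !mxE.
have sw a b c : partial a g x b c = partial a g x c b by rewrite -{1}dgs mxE.
rewrite (sw k l j) (sw j k l) (sw l k j).
by field.
Qed.

Lemma row_jacobi x w k :
  row k (jacobi g x w) = \sum_j w 0 j *: (w *m curv g k j x).
Proof.
apply/rowP => l; rewrite mxE [LHS]mxE summxE; apply: eq_bigr => j _.
by rewrite [RHS]mxE.
Qed.

Lemma sum_connection x w b (K : 'I_n -> 'M[R]_n) :
  \sum_a connection g x w b a *: K a =
  \sum_m w 0 m *: \sum_a christoffel g m x b a *: K a.
Proof.
under [RHS]eq_bigr do rewrite scaler_sumr; rewrite exchange_big /=.
apply: eq_bigr => a _; rewrite summxE scaler_suml.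
by apply: eq_bigr => m _; rewrite mxE scalerA.
Qed.

(** The covariant derivative in direction w involves the Christoffel symbols
    only through the connection matrix of w; likewise below. *)
Lemma sum_nabla_curv x w i j :
  \sum_m w 0 m *: nabla_curv g m i j x =
  \sum_m w 0 m *: partial m (curv g i j) x
  + curv g i j x *m connection g x w - connection g x w *m curv g i j x
  - \sum_a connection g x w i a *: curv g a j x
  - \sum_a connection g x w j a *: curv g i a x.
Proof.
rewrite !sum_connection /connection mulmx_sumr mulmx_suml -big_split -!sumrB /=.
apply: eq_bigr => m _.
by rewrite -scalemxAr -scalemxAl -scalerDr -!scalerBr.
Qed.

Lemma row_jacobi' x w k :
  row k (jacobi' g x w) =
  \sum_j w 0 j *: (w *m \sum_m w 0 m *: nabla_curv g m k j x).
Proof.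
under eq_bigr do rewrite mulmx_sumr scaler_sumr.
rewrite exchange_big /=; apply/rowP => l; rewrite mxE [LHS]mxE summxE.
apply: eq_bigr => m _; rewrite summxE; apply: eq_bigr => j _.
by rewrite -scalemxAr scalerA [in RHS]mxE [w 0 m * _]mulrC.
Qed.

Lemma mxtrace_jacobi x w : \tr (jacobi g x w) = bilin (ricci g x) w w.
Proof.
rewrite /bilin /mxtrace mxE.
transitivity (\sum_l \sum_k \sum_j w 0 j * (w 0 l * curv g k j x l k)).
  rewrite exchange_big /=; apply: eq_bigr => k _; rewrite mxE exchange_big /=.
  by apply: eq_bigr => j _; rewrite mxE mulr_sumr.
apply: eq_bigr => l _; rewrite exchange_big !mxE mulr_suml /=.
apply: eq_bigr => j _; rewrite !mxE mulrC mulrCA mulr_sumr mulr_sumr.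
by apply: eq_bigr => k _; ring.
Qed.

Lemma D1_bilin x w : D1 g x w = bilin (\sum_m w 0 m *: nabla_ricci g m x) w w.
Proof.
rewrite /bilin mulmx_sumr mulmx_suml summxE; apply: eq_bigr => m _.
by rewrite -scalemxAr -scalemxAl mxE.
Qed.

Lemma sum_nabla_ricci x w : \sum_m w 0 m *: nabla_ricci g m x =
  \sum_m w 0 m *: partial m (ricci g) x
  - connection g x w *m ricci g x - ricci g x *m (connection g x w)^T.
Proof.
rewrite /connection linear_sum mulmx_sumr mulmx_suml -!sumrB /=.
apply: eq_bigr => m _.
by rewrite linearZ /= -scalemxAr -scalemxAl -!scalerBr.
Qed.

Lemma sum_nabla2_ricci x w k : \sum_m w 0 m *: nabla2_ricci g m k x =
  \sum_m w 0 m *: partial m (nabla_ricci g k) x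
  - connection g x w *m nabla_ricci g k x - nabla_ricci g k x *m (connection g x w)^T
  - \sum_a connection g x w k a *: nabla_ricci g a x.
Proof.
rewrite sum_connection /connection linear_sum mulmx_sumr mulmx_suml -!sumrB /=.
apply: eq_bigr => m _.
by rewrite linearZ /= -scalemxAr -scalemxAl -!scalerBr.
Qed.

End PointwiseIdentities.

Section AlongGeodesic.
Context {R : realType} {n : nat}.
Variables (U : set 'rV[R]_n) (Uopen : open U) (g : 'rV[R]_n -> 'M[R]_n).
Hypotheses (gsm : smooth_on U g) (gu : forall x, U x -> g x \in unitmx).
Hypothesis (gs : forall x, U x -> (g x)^T = g x).
Variables (c w : R -> 'rV[R]_n) (t : R).
Let G s := connection g (c s) (w s).
Hypotheses (Uc : U (c t)) (dc : is_derive t 1 c (w t))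
  (dw : is_derive t 1 w (- (w t *m G t))).

(** B is the covariant derivative at t of the field of endomorphisms A along
    the curve c with velocity w. *)
Definition cov_derive_is (A : R -> 'M[R]_n) (B : 'M[R]_n) : Prop :=
  is_derive t 1 A (B - A t *m G t + G t *m A t).

Lemma partial_metric_sym x k : U x -> (partial k g x)^T = partial k g x.
Proof.
move=> Ux; apply/matrixP => i j.
have dg : differentiable g x by exact: (gsm [::]).
rewrite mxE !partial_mx //; apply: (partial_eq Uopen); last exact: mem_set.
by move=> y /set_mem /gs {1}<-; rewrite mxE.
Qed.

Lemma is_derive_metric :
  is_derive t 1 (fun s => g (c s)) (G t *m g (c t) + g (c t) *m (G t)^T).
Proof.
have dg : differentiable g (c t) by exact: (gsm [::]).
apply: is_derive_eq (is_derive_along dg dc) _.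
rewrite /G /connection linear_sum mulmx_sumr mulmx_suml -big_split /=.
apply: eq_bigr => k _; rewrite linearZ /= -scalemxAl -scalemxAr -scalerDr.
by rewrite -partial_metric ?gu ?gs // => l; exact: partial_metric_sym.
Qed.

(** Covariant differentiation preserves self-adjointness since the metric is
    parallel. *)
Lemma cov_derive_selfadjoint A B : cov_derive_is A B ->
  (\forall s \near t, A s *m g (c s) = g (c s) *m (A s)^T) ->
  B *m g (c t) = g (c t) *m B^T.
Proof.
move=> dA sA; have := nbhs_singleton sA.
have dl := is_derive_mulmx dA is_derive_metric.
have dr := is_derive_mulmx is_derive_metric (is_derive_trmx dA).
have := is_derive_unique (near_eq_is_derive sA dl) dr.
move=> + sAt; rewrite [(_ + _)^T]linearD /= [(_ - _)^T]linearB /= !trmx_mul.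
rewrite !mulmxDl !mulmxDr mulNmx mulmxN !mulmxA.
rewrite -[G t *m A t *m g (c t)]mulmxA sAt !mulmxA.
set b := B *m _; set b' := _ *m B^T; set p := _ *m G t *m _.
set q := G t *m _ *m _; set r := _ *m (G t)^T; set s := _ *m (G t)^T *m _.
rewrite [b - p + q]addrAC subrKA [q + s]addrC [b' - s + r]addrAC.
by rewrite [RHS]addrC subrKA -!addrA [q + r]addrC => /addIr.
Qed.

(** The velocity of a geodesic is parallel. *)
Lemma cov_derive_kernel A B : cov_derive_is A B ->
  (\forall s \near t, w s *m A s = 0) -> w t *m B = 0.
Proof.
move=> dA wA; have := nbhs_singleton wA.
have := is_derive_unique (near_eq_is_derive wA (is_derive_mulmx dw dA)) (is_derive_cst _ _ _).
move=> + wAt; rewrite mulmxDr mulmxBr !mulmxA wAt mul0mx subr0 mulNmx => <-.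
by rewrite addrC addrK.
Qed.

Lemma cov_derive_mxtrace A B : cov_derive_is A B ->
  is_derive t 1 (fun s => \tr (A s)) (\tr B).
Proof.
move=> /is_derive_mxtrace dA; apply: is_derive_eq dA _.
by rewrite linearD linearB /= [\tr (G t *m _)]mxtrace_mulC subrK.
Qed.

Lemma cov_derive_mul A B A' B' : cov_derive_is A B -> cov_derive_is A' B' ->
  cov_derive_is (fun s => A s *m A' s) (B *m A' t + A t *m B').
Proof.
move=> dA dA'; apply: is_derive_eq (is_derive_mulmx dA dA') _.
rewrite mulmxDl mulmxDr mulmxBl mulmxBr !mulmxA.
set b := B *m _; set p := A t *m G t *m _; set q := G t *m _ *m _.
set e := A t *m B'; set r := _ *m _ *m G t.
by rewrite [b - p + q]addrAC [e - r + p]addrC subrKA addrAC !addrA.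
Qed.

(** The velocity being parallel, only the curvature tensor contributes to the
    covariant derivative of the Jacobi operator of the velocity. *)
Lemma cov_derive_jacobi :
  cov_derive_is (fun s => jacobi g (c s) (w s)) (jacobi' g (c t) (w t)).
Proof.
have dK k j : is_derive t 1 (fun s => curv g k j (c s))
    (\sum_m w t 0 m *: partial m (curv g k j) (c t)).
  apply: is_derive_along => //.
  exact: diffn_on_differentiable (diffn_on_curv Uopen gsm gu 0 k j) Uc.
have dwj j : is_derive t 1 (fun s => w s 0 j) ((- (w t *m G t)) 0 j).
  by have /is_derive_mx := dw; apply.
apply/is_derive_mx => k l.
have dr := is_derive_summx (fun j => is_derive_scalemx (dwj j) (is_derive_mulmx dw (dK k j))).
have rowE : (fun s => \sum_j w s 0 j *: (w s *m curv g k j (c s))) =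
    (fun s => row k (jacobi g (c s) (w s))).
  by apply/funext => s; rewrite row_jacobi.
move: dr; rewrite rowE => /is_derive_mx /(_ 0 l).
rewrite (_ : (fun s => row k (jacobi g (c s) (w s)) 0 l) =
  (fun s => jacobi g (c s) (w s) k l)); last first.
  by apply/funext => s; rewrite [LHS]mxE.
move=> dJ; apply: is_derive_eq dJ _.
rewrite (_ : (jacobi' _ _ _ - _ + _) k l =
  row k (jacobi' g (c t) (w t) - jacobi g (c t) (w t) *m G t
         + G t *m jacobi g (c t) (w t)) 0 l); last by rewrite [RHS]mxE.
congr (fun_of_matrix _ 0 l); rewrite [RHS]linearD /= [row k (_ - _)]linearB /=.
have -> : row k (G t *m jacobi g (c t) (w t)) =
    \sum_j w t 0 j *: (w t *m \sum_a G t k a *: curv g a j (c t)).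
  rewrite row_mul mulmx_sum_row.
  under [RHS]eq_bigr do rewrite mulmx_sumr scaler_sumr.
  rewrite exchange_big; apply: eq_bigr => a _; rewrite mxE row_jacobi scaler_sumr.
  by apply: eq_bigr => j _; rewrite -scalemxAr !scalerA mulrC.
rewrite row_mul row_jacobi row_jacobi' mulmx_suml.
rewrite -sumrB -big_split /=.
(* The derivative of the factor w in front matches the correction of the
   second index of the curvature tensor. *)
have rot : \sum_j (- (w t *m G t)) 0 j *: (w t *m curv g k j (c t)) =
   - \sum_j w t 0 j *: (w t *m \sum_a G t j a *: curv g k a (c t)).
  under [in RHS]eq_bigr do rewrite mulmx_sumr scaler_sumr.
  rewrite exchange_big -sumrN; apply: eq_bigr => a _; rewrite mxE scaleNr; congr (- _).
  rewrite mxE scaler_suml; apply: eq_bigr => j _.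
  by rewrite -scalemxAr scalerA.
rewrite big_split /= rot -sumrN -big_split /=; apply: eq_bigr => j _.
rewrite sum_nabla_curv -/(G t) mulNmx -!scalemxAl -!scalerN -!scalerDr.
congr (_ *: _).
move: (\sum_a _ *: curv g a j _) (\sum_a _ *: curv g k a _) (curv g k j (c t)) => T T' K.
rewrite !mulmxBr mulmxDr !mulmxA; set S := \sum_m _.
set b := _ *m _ *m K; set d := _ *m K *m _; set a := w t *m S.
set e := w t *m T; rewrite [_ - e - _]addrAC [_ - d]addrAC subrK.
rewrite [_ - d]addrAC [a + d - b - d]addrAC addrK [- b + a]addrC; exact: addrC.
Qed.

(** Writing the derivative of the velocity by the geodesic equation turns the
    derivative of N(w, w) into a covariant derivative of N. *)
Lemma is_derive_bilin (N : R -> 'M[R]_n) dN :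
  is_derive t 1 N dN ->
  is_derive t 1 (fun s => bilin (N s) (w s) (w s))
    (bilin (dN - G t *m N t - N t *m (G t)^T) (w t) (w t)).
Proof.
move=> hN.
have /is_derive_mx /(_ 0 0) := is_derive_mulmx (is_derive_mulmx dw hN) (is_derive_trmx dw).
move=> h; apply: is_derive_eq h _.
rewrite /bilin; congr (fun_of_matrix _ 0 0).
rewrite linearN /= trmx_mul mulmxN mulNmx mulmxDl !mulmxBr !mulmxBl mulNmx !mulmxA.
by rewrite [- _ + _]addrC.
Qed.

Lemma is_derive_ricci :
  is_derive t 1 (fun s => bilin (ricci g (c s)) (w s) (w s)) (D1 g (c t) (w t)).
Proof.
have dr : differentiable (ricci g) (c t).
  exact: diffn_on_differentiable (diffn_on_ricci Uopen gsm gu 0) Uc.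
apply: is_derive_eq (is_derive_bilin (is_derive_along dr dc)) _.
by rewrite D1_bilin sum_nabla_ricci.
Qed.

Lemma is_derive_D1 :
  is_derive t 1 (fun s => D1 g (c s) (w s))
    (\sum_m \sum_k w t 0 m * w t 0 k * bilin (nabla2_ricci g m k (c t)) (w t) (w t)).
Proof.
have dr k : is_derive t 1 (fun s => nabla_ricci g k (c s))
    (\sum_m w t 0 m *: partial m (nabla_ricci g k) (c t)).
  apply: is_derive_along => //.
  exact: diffn_on_differentiable (diffn_on_nabla_ricci Uopen gsm gu 0 k) Uc.
have dwj j : is_derive t 1 (fun s => w s 0 j) ((- (w t *m G t)) 0 j).
  by have /is_derive_mx := dw; apply.
have := is_derive_bilin (is_derive_summx (fun k => is_derive_scalemx (dwj k) (dr k))).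
rewrite (_ : (fun s => bilin _ (w s) (w s)) = (fun s => D1 g (c s) (w s))); last first.
  by apply/funext => s; rewrite D1_bilin.
move=> h; apply: is_derive_eq h _.
transitivity (bilin (\sum_k w t 0 k *: \sum_m w t 0 m *: nabla2_ricci g m k (c t))
  (w t) (w t)).
  congr (bilin _ _ _); rewrite big_split /= [G t *m \sum_i _]mulmx_sumr mulmx_suml.
  have -> : \sum_k (- (w t *m G t)) 0 k *: nabla_ricci g k (c t) =
      - \sum_k w t 0 k *: \sum_a G t k a *: nabla_ricci g a (c t).
    under [in RHS]eq_bigr do rewrite scaler_sumr.
    rewrite exchange_big -sumrN; apply: eq_bigr => a _; rewrite mxE scaleNr; congr (- _).
    by rewrite mxE scaler_suml; apply: eq_bigr => j _; rewrite scalerA.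
  rewrite -sumrN -big_split -!sumrB /=; apply: eq_bigr => k _.
  rewrite sum_nabla2_ricci -/(G t) -scalemxAr -scalemxAl -!scalerN -!scalerDr; congr (_ *: _).
  by rewrite -!addrA addrC -!addrA.
rewrite /bilin mulmx_sumr mulmx_suml summxE exchange_big /=; apply: eq_bigr => k _.
rewrite scaler_sumr mulmx_sumr mulmx_suml summxE; apply: eq_bigr => m _.
by rewrite scalerA -scalemxAr -scalemxAl mxE [w t 0 k * _]mulrC.
Qed.

End AlongGeodesic.

(** * Homogeneous polynomials *)

Section HomogeneousPolynomials.
Context {R : realType} {n : nat}.
Implicit Types (f h : 'rV[R]_n -> R) (d e : nat).

Lemma homogeneous_eq d f h : f =1 h ->
  homogeneous_polynomial d f -> homogeneous_polynomial d h.
Proof. by move=> fh [q [hq fq]]; exists q; split=> // X; rewrite -fh. Qed.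

Lemma homogeneous_cst (a : R) : homogeneous_polynomial 0 (fun _ : 'rV[R]_n => a).
Proof.
exists (a *: (1 : mpoly n R)); split=> [|X]; first exact/dhomogZ/dhomog1.
by rewrite mevalZ meval1 mulr1.
Qed.

Lemma homogeneous_coord i : homogeneous_polynomial 1 (fun X : 'rV[R]_n => X 0 i).
Proof.
exists (mpolyX R (mnm1 i)); split=> [|X]; first by rewrite dhomogX; apply/eqP; exact: mdeg1.
by rewrite mevalXU.
Qed.

Lemma homogeneousD d f h : homogeneous_polynomial d f -> homogeneous_polynomial d h ->
  homogeneous_polynomial d (fun X => f X + h X).
Proof.
move=> [q [hq fq]] [q' [hq' hq'']]; exists (q + q'); split=> [|X]; first exact: dhomogD.
by rewrite mevalD fq hq''.
Qed.

Lemma homogeneousM d e f h : homogeneous_polynomial d f -> homogeneous_polynomial e h ->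
  homogeneous_polynomial (d + e) (fun X => f X * h X).
Proof.
move=> [q [hq fq]] [q' [hq' hq'']]; exists (q * q'); split=> [|X]; first exact: dhomogM.
by rewrite mevalM fq hq''.
Qed.

Lemma homogeneousZ d a f : homogeneous_polynomial d f ->
  homogeneous_polynomial d (fun X => a * f X).
Proof. exact: homogeneousM (homogeneous_cst a). Qed.

Lemma homogeneous_sum d (I : Type) (r : seq I) (P : pred I) (f : I -> 'rV[R]_n -> R) :
  (forall i, homogeneous_polynomial d (f i)) ->
  homogeneous_polynomial d (fun X => \sum_(i <- r | P i) f i X).
Proof.
move=> hf; elim: r => [|i r IH].
  exists 0; split=> [|X]; first exact: dhomog0.
  by rewrite big_nil meval0.
case Pi : (P i).
  by apply: homogeneous_eq (homogeneousD (hf i) IH) => X; rewrite big_cons Pi.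
by apply: homogeneous_eq IH => X; rewrite big_cons Pi.
Qed.

Lemma homogeneous_mxtrace_mul m d e (A B : 'rV[R]_n -> 'M[R]_m) :
  (forall i j, homogeneous_polynomial d (fun X => A X i j)) ->
  (forall i j, homogeneous_polynomial e (fun X => B X i j)) ->
  homogeneous_polynomial (d + e) (fun X => \tr (A X *m B X)).
Proof.
move=> hA hB; apply: homogeneous_sum => i.
apply: (homogeneous_eq (f := fun X => \sum_j A X i j * B X j i)).
  by move=> X; rewrite mxE.
by apply: homogeneous_sum => j; exact: homogeneousM.
Qed.

Lemma homogeneous_bilin (N : 'M[R]_n) : homogeneous_polynomial 2 (fun X => bilin N X X).
Proof.
apply: (homogeneous_eq (f := fun X => \sum_j (\sum_i N i j * X 0 i) * X 0 j)).
  move=> X; rewrite /bilin mxE; apply: eq_bigr => j _; rewrite !mxE; congr (_ * _).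
  by apply: eq_bigr => i _; rewrite mulrC.
apply: homogeneous_sum => j; apply: (@homogeneousM 1 1); last exact: homogeneous_coord.
by apply: homogeneous_sum => i; apply: homogeneousZ; exact: homogeneous_coord.
Qed.

Variables (g : 'rV[R]_n -> 'M[R]_n) (x : 'rV[R]_n).

Let homogeneous_mulmx (K : 'M[R]_n) l : homogeneous_polynomial 1 (fun X => (X *m K) 0 l).
Proof.
apply: (homogeneous_eq (f := fun X => \sum_i K i l * X 0 i)).
  by move=> X; rewrite mxE; apply: eq_bigr => i _; rewrite mulrC.
by apply: homogeneous_sum => i; apply: homogeneousZ; exact: homogeneous_coord.
Qed.

Lemma homogeneous_jacobi k l : homogeneous_polynomial 2 (fun X => jacobi g x X k l).
Proof.
apply: (homogeneous_eq (f := fun X => \sum_j X 0 j * (X *m curv g k j x) 0 l)).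
  by move=> X; rewrite mxE.
apply: homogeneous_sum => j.
by apply: (@homogeneousM 1 1); [exact: homogeneous_coord|exact: homogeneous_mulmx].
Qed.

Lemma homogeneous_jacobi' k l : homogeneous_polynomial 3 (fun X => jacobi' g x X k l).
Proof.
apply: (homogeneous_eq (f := fun X => \sum_m \sum_j
    X 0 m * X 0 j * (X *m nabla_curv g m k j x) 0 l)).
  by move=> X; rewrite mxE.
apply: homogeneous_sum => m; apply: homogeneous_sum => j.
apply: (@homogeneousM 2 1); last exact: homogeneous_mulmx.
by apply: (@homogeneousM 1 1); exact: homogeneous_coord.
Qed.

Lemma homogeneous_D1 : homogeneous_polynomial 3 (D1 g x).
Proof.
apply: homogeneous_sum => m; apply: (@homogeneousM 1 2); first exact: homogeneous_coord.
exact: homogeneous_bilin.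
Qed.

Lemma homogeneous_D2 : homogeneous_polynomial 4 (D2 g x).
Proof.
apply: homogeneousD; last first.
  apply: homogeneous_sum => m; apply: homogeneous_sum => k.
  apply: (@homogeneousM 2 2); last exact: homogeneous_bilin.
  by apply: (@homogeneousM 1 1); exact: homogeneous_coord.
apply: homogeneousD.
  by apply: homogeneousZ; apply: (@homogeneous_mxtrace_mul _ 2 2); exact: homogeneous_jacobi.
apply: (homogeneous_eq (f := fun X => -1 * (bilin (ricci g x) X X * bilin (ricci g x) X X))).
  by move=> X; rewrite mulN1r -expr2.
by apply: homogeneousZ; apply: (@homogeneousM 2 2); exact: homogeneous_bilin.
Qed.

Lemma homogeneousB d f h : homogeneous_polynomial d f -> homogeneous_polynomial d h ->
  homogeneous_polynomial d (fun X => f X - h X).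
Proof.
move=> hf hh; apply: homogeneous_eq (homogeneousD hf (homogeneousZ (-1) hh)) => X.
by rewrite mulN1r.
Qed.

(** The trace-free parts on the plane orthogonal to X satisfy
    tr(A0 B0) = tr(AB) - tr(A) tr(B) / 2, which is polynomial in X for Jacobi
    operators; this is P after that substitution. *)
Definition PP_poly X :=
  let J := jacobi g x X in let J' := jacobi' g x X in
  (\tr (J *m J) - 2^-1 * \tr J * \tr J) * D2 g x X
  - (\tr (J' *m J) - 2^-1 * \tr J' * \tr J) * D1 g x X.

Lemma homogeneous_PP_poly : homogeneous_polynomial 8 PP_poly.
Proof.
have tJ : homogeneous_polynomial 2 (fun X => \tr (jacobi g x X)).
  by apply: homogeneous_sum => i; exact: homogeneous_jacobi.
have tJ' : homogeneous_polynomial 3 (fun X => \tr (jacobi' g x X)).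
  by apply: homogeneous_sum => i; exact: homogeneous_jacobi'.
apply: homogeneousB.
  apply: (@homogeneousM 4 4); last exact: homogeneous_D2.
  apply: homogeneousB.
    by apply: (@homogeneous_mxtrace_mul _ 2 2); exact: homogeneous_jacobi.
  by apply: (@homogeneousM 2 2) => //; exact: homogeneousZ.
apply: (@homogeneousM 5 3); last exact: homogeneous_D1.
apply: homogeneousB.
  apply: (@homogeneous_mxtrace_mul _ 3 2); [exact: homogeneous_jacobi'|exact: homogeneous_jacobi].
by apply: (@homogeneousM 3 2) => //; exact: homogeneousZ.
Qed.

End HomogeneousPolynomials.

(** * From the Riccati equation to the identity *)

Lemma bilin_delta (R : realType) n (h : 'M[R]_n) i j :
  bilin h (delta_mx 0 i) (delta_mx 0 j) = h i j.
Proof. by rewrite /bilin -rowE trmx_delta -colE !mxE. Qed.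

Lemma bilin_selfadjoint (R : realType) n (h A : 'M[R]_n) :
  (forall v w, bilin h (v *m A) w = bilin h v (w *m A)) -> A *m h = h *m A^T.
Proof.
move=> sA; apply/matrixP => i j; rewrite -!bilin_delta.
by have := sA (delta_mx 0 i) (delta_mx 0 j); rewrite /bilin trmx_mul !mulmxA.
Qed.

Lemma posdef_unitmx (R : realType) n (h : 'M[R]_n) :
  (forall v : 'rV[R]_n, v != 0 -> 0 < bilin h v v) -> h \in unitmx.
Proof.
move=> hp; rewrite -row_free_unit -kermx_eq0; apply/eqP/row_matrixP => i.
rewrite row0; apply/eqP/negP => /negP /hp; rewrite /bilin -row_mul mulmx_ker row0.
by rewrite mul0mx mxE ltxx.
Qed.

Section Scaling.
Context {R : realType} {n : nat} (g : 'rV[R]_n -> 'M[R]_n) (x : 'rV[R]_n).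
Implicit Types (X : 'rV[R]_n) (a : R).

Let scalemxE m k a (A : 'M[R]_(m, k)) i j : (a *: A) i j = a * A i j.
Proof. by rewrite mxE. Qed.

Lemma bilinZ (h : 'M[R]_n) a X : bilin h (a *: X) (a *: X) = a ^+ 2 * bilin h X X.
Proof.
by rewrite /bilin linearZ /= -!scalemxAl -scalemxAr scalerA mxE expr2.
Qed.

Lemma jacobiZ a X : jacobi g x (a *: X) = a ^+ 2 *: jacobi g x X.
Proof.
apply/matrixP => k l; rewrite [LHS]mxE [RHS]mxE [in RHS]mxE mulr_sumr.
by apply: eq_bigr => j _; rewrite -scalemxAl !scalemxE; ring.
Qed.

Lemma jacobi'Z a X : jacobi' g x (a *: X) = a ^+ 3 *: jacobi' g x X.
Proof.
apply/matrixP => k l; rewrite [LHS]mxE [RHS]mxE [in RHS]mxE mulr_sumr.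
apply: eq_bigr => m _; rewrite mulr_sumr.
by apply: eq_bigr => j _; rewrite -scalemxAl !scalemxE; ring.
Qed.

Lemma D1Z a X : D1 g x (a *: X) = a ^+ 3 * D1 g x X.
Proof.
by rewrite /D1 mulr_sumr; apply: eq_bigr => m _; rewrite bilinZ scalemxE; ring.
Qed.

Lemma D2Z a X : D2 g x (a *: X) = a ^+ 4 * D2 g x X.
Proof.
rewrite /D2 /endo_comp jacobiZ bilinZ -scalemxAl -scalemxAr scalerA mxtraceZ.
rewrite [RHS]mulrDr; congr (_ + _); first by ring.
rewrite mulr_sumr; apply: eq_bigr => m _; rewrite mulr_sumr.
by apply: eq_bigr => k _; rewrite bilinZ !scalemxE; ring.
Qed.

Lemma jacobi0 : jacobi g x 0 = 0.
Proof. by rewrite -[in LHS](scale0r 0) jacobiZ expr0n scale0r. Qed.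

Lemma Jo0 : Jo g x 0 = 0.
Proof.
by rewrite /Jo /tracefree_perp jacobi0 conjmx0 mxtrace0 mulr0 raddf0 subrr.
Qed.

Lemma PP0 : PP g x 0 = 0.
Proof. by rewrite /PP /endo_comp Jo0 mul0mx mulmx0 mxtrace0 !mul0r subrr. Qed.

End Scaling.

(** What the solution u of the Riccati equation leaves behind at one point.  All
    conditions are homogeneous in X and u, so that they extend from unit vectors
    to all tangent vectors. *)
Definition riccati_algebra (R : realType) n (g : 'rV[R]_n -> 'M[R]_n)
    (x X : 'rV[R]_n) (u : 'M[R]_n) :=
  let J := jacobi g x X in let J' := jacobi' g x X in
  [/\ [/\ u *m g x = g x *m u^T, J *m g x = g x *m J^T & J' *m g x = g x *m J'^T],
      [/\ X *m u = 0, X *m J = 0 & X *m J' = 0] &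
      [/\ \tr u = 0, \tr (u *m u) = - \tr J, 2 * \tr (u *m J) = D1 g x X
        & 2 * \tr (u *m J') = D2 g x X]].

Lemma riccati_algebraZ (R : realType) n (g : 'rV[R]_n -> 'M[R]_n) (x X : 'rV[R]_n) u a :
  riccati_algebra g x X u -> riccati_algebra g x (a *: X) (a *: u).
Proof.
rewrite /riccati_algebra /= => -[[su sJ sJ'] [ku kJ kJ'] [u0 uu uJ uJ']].
rewrite jacobiZ jacobi'Z D1Z D2Z; split; split.
- by rewrite linearZ /= -scalemxAl -scalemxAr su.
- by rewrite linearZ /= -scalemxAl -scalemxAr sJ.
- by rewrite linearZ /= -scalemxAl -scalemxAr sJ'.
- by rewrite -scalemxAl -scalemxAr ku !scaler0.
- by rewrite -scalemxAl -scalemxAr kJ !scaler0.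
- by rewrite -scalemxAl -scalemxAr kJ' !scaler0.
- by rewrite linearZ /= u0 mulr0.
- by rewrite -scalemxAl -scalemxAr scalerA !mxtraceZ uu; ring.
- by rewrite -scalemxAl -scalemxAr scalerA linearZ /= -uJ; ring.
- by rewrite -scalemxAl -scalemxAr scalerA linearZ /= -uJ'; ring.
Qed.

Lemma solve_riccati (V : zmodType) (d a b s j : V) :
  d + a - b + s + j = 0 -> d = - s - j - a + b.
Proof.
move=> /eqP; rewrite addr_eq0 => /eqP E.
by rewrite [- s - j]addrC -E addrK [d + a - b - a]addrAC addrK subrK.
Qed.

Section Manifold.
Context {R : realType} (M : riemannian_manifold R 3).
Hypothesis hM : has_tracefree_riccati_solutions M.
Variables (p : M) (i : chart_index M).
Hypothesis ip : dom i p.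
Let g := metric i.
Let U := chart i @` dom i.

Lemma metric_unit x : U x -> g x \in unitmx.
Proof. by move=> [q iq <-]; apply: posdef_unitmx => v; exact: metric_pos. Qed.

Lemma metric_tr x : U x -> (g x)^T = g x.
Proof. by move=> [q iq <-]; exact: Defs.metric_sym. Qed.

Lemma rank_perp_tangent x (X : 'rV[R]_3) : U x -> X != 0 ->
  \rank (kermx (g x *m X^T)) = 2%N.
Proof.
move=> Ux X0; apply: (rank_perp (metric_tr Ux) _ X0).
by case: Ux => q iq <- v; exact: metric_pos.
Qed.

(** Taking the trace of u' + u^2 + J = 0 gives tr(u^2) = - ric.  The derivative
    of this along the geodesic is 2 tr(uJ) = D1, as tr(u^3) = 0 for a trace-free
    u with a kernel; the second derivative is 2 tr(uJ') = D2, by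
    tr(u^2 J) = tr(u^2) tr(J) / 2.  The equation also shows that J is
    self-adjoint and kills the velocity, and J' inherits both as the covariant
    derivative of J. *)
Lemma unit_riccati_algebra v : bilin (g (chart i p)) v v = 1 ->
  exists u, riccati_algebra g (chart i p) v u.
Proof.
move=> v1; have [eps [gamma [u [e0 geo g0 v0 [[_ ric] sol]]]]] := hM ip v1.
pose c := curve_coord gamma i; pose w := velocity gamma i.
pose J s := jacobi g (c s) (w s); pose ui := u i.
have Uo : open U by exact: img_open.
have gsm : smooth_on U g by exact: metric_smooth.
have cont0 : {for 0, continuous gamma}.
  by have /geo [] : - eps < 0 < eps by rewrite oppr_lt0 e0.
have Q : \forall t \near (0 : R), (- eps < t < eps) /\ dom i (gamma t).
  near=> t; split.
    rewrite -ltr_norml; near: t; exists eps => //= y; rewrite /ball /= sub0r normrN; apply.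
  near: t; apply: cont0; rewrite g0; apply: open_nbhs_nbhs; split=> //; exact: dom_open.
have Uc t : dom i (gamma t) -> U (c t) by move=> ?; exists (gamma t).
have dc t : - eps < t < eps -> dom i (gamma t) -> is_derive t 1 c (w t).
  move=> te it; have [_ /(_ i it) [dc _ _]] := geo t te.
  apply: DeriveDef; first exact: dc.
  by rewrite -derive1E.
have dw t : - eps < t < eps -> dom i (gamma t) ->
    is_derive t 1 w (- (w t *m connection g (c t) (w t))).
  move=> te it; have [_ /(_ i it) [_ dw /eqP]] := geo t te.
  rewrite addr_eq0 => /eqP E; apply: DeriveDef; first exact: dw.
  by rewrite -derive1E E.
(* The covariant derivative of u prescribed by the Riccati equation. *)
pose B t := - (ui t *m ui t) - J t.
have du t : - eps < t < eps -> dom i (gamma t) -> cov_derive_is g c w t ui (B t).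
  move=> te it; have [du E] := ric t te i it.
  apply: DeriveDef; first exact: du.
  by rewrite -derive1E; exact: solve_riccati E.
have su t : - eps < t < eps -> dom i (gamma t) ->
    [/\ ui t *m g (c t) = g (c t) *m (ui t)^T, \tr (ui t) = 0 & w t *m ui t = 0].
  by move=> te it; have [[/bilin_selfadjoint]] := sol t te i it.
have w0 : \forall t \near (0 : R), w t != 0.
  have [te it] := nbhs_singleton Q.
  have : {for 0, continuous w}.
    by apply: differentiable_continuous; apply/derivable1_diffP; have [] := dw 0 te it.
  move=> cw; apply: cvgr_neq0 cw _; rewrite /w v0; apply/eqP => E.
  by move: v1; rewrite E /bilin mul0mx mul0mx mxE => /eqP; rewrite eq_sym oner_eq0.
have near_near (P : R -> Prop) :
    (\forall t \near 0, P t) -> \forall t \near 0, \forall s \near t, P s.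
  by move=> /nbhs_interior.
have sub_perp A t : dom i (gamma t) -> A *m g (c t) = g (c t) *m A^T -> w t *m A = 0 ->
    (A <= row_base (kermx (g (c t) *m (w t)^T)))%MS.
  by move=> it; exact: selfadjoint_sub_perp.
(* The Riccati equation itself, at all times near 0. *)
have first_order : \forall t \near (0 : R),
    [/\ J t *m g (c t) = g (c t) *m (J t)^T, w t *m J t = 0 &
        \tr (ui t *m ui t) = - \tr (J t)].
  near=> t; have Qt : \forall s \near t, (- eps < s < eps) /\ dom i (gamma s).
    by near: t; exact: near_near Q.
  have [te it] := nbhs_singleton Qt; have [su_t tu_t ku_t] := su t te it.
  have sB : B t *m g (c t) = g (c t) *m (B t)^T.
    apply: (cov_derive_selfadjoint Uo gsm metric_unit metric_tr
      (Uc t it) (dc t te it) (du t te it)).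
    by apply: filterS Qt => s [se is_]; have [] := su s se is_.
  have kB : w t *m B t = 0.
    apply: (cov_derive_kernel (dw t te it) (du t te it)).
    by apply: filterS Qt => s [se is_]; have [] := su s se is_.
  have tB : \tr (B t) = 0.
    apply: (is_derive_unique (cov_derive_mxtrace (du t te it))).
    apply: near_eq_is_derive (is_derive_cst 0 _ _).
    by apply: filterS Qt => s [se is_]; have [] := su s se is_.
  have JE : J t = - (ui t *m ui t) - B t by rewrite /B opprB addrC subrK.
  split.
  - rewrite JE mulmxBl mulNmx linearB linearN /= mulmxBr mulmxN sB trmx_mul.
    by rewrite -mulmxA su_t !mulmxA su_t.
  - by rewrite JE mulmxBr mulmxN mulmxA ku_t mul0mx kB oppr0 addr0.
  - move: tB; rewrite /B linearB linearN /= => /eqP.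
    by rewrite subr_eq0 => /eqP <-; rewrite opprK.
(* The first derivative of tr(u^2) = - ric, at all times near 0. *)
have second_order : \forall t \near (0 : R), 2 * \tr (ui t *m J t) = D1 g (c t) (w t).
  near=> t; have Qt : \forall s \near t, (- eps < s < eps) /\ dom i (gamma s).
    by near: t; exact: near_near Q.
  have Ft : \forall s \near t, [/\ J s *m g (c s) = g (c s) *m (J s)^T, w s *m J s = 0 &
        \tr (ui s *m ui s) = - \tr (J s)] by near: t; exact: near_near first_order.
  have wt0 : w t != 0 by near: t.
  have [te it] := nbhs_singleton Qt; have [su_t tu_t ku_t] := su t te it.
  have d1 := cov_derive_mxtrace (cov_derive_mul (du t te it) (du t te it)).
  have dr := is_derive_ricci Uo gsm metric_unit (Uc t it) (dc t te it) (dw t te it).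
  have d2 : is_derive t 1 (fun s => - bilin (ricci g (c s)) (w s) (w s)) (- D1 g (c t) (w t)).
    exact: is_deriveN.
  have E : \tr (B t *m ui t + ui t *m B t) = - D1 g (c t) (w t).
    apply: (is_derive_unique d1); apply: near_eq_is_derive d2.
    by apply: filterS Ft => s [_ _ ->]; rewrite mxtrace_jacobi.
  have uV := sub_perp _ _ it su_t ku_t.
  have u3 : \tr (ui t *m (ui t *m ui t)) = 0.
    have r2 := rank_perp_tangent (Uc t it) wt0.
    by rewrite mulmxA (mxtrace_square_mul r2 (row_base_free _) uV uV tu_t) tu_t mulr0.
  move: E; rewrite linearD /= [\tr (B t *m _)]mxtrace_mulC /B mulmxBr mulmxN.
  rewrite linearB linearN /= u3 oppr0 sub0r -opprD => /oppr_inj <-; ring.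
have [te it] := nbhs_singleton Q; have [su_0 tu_0 ku_0] := su 0 te it.
have [sJ kJ uu] := nbhs_singleton first_order.
have dJ := cov_derive_jacobi Uo gsm metric_unit (Uc 0 it) (dc 0 te it) (dw 0 te it).
have sJ' : jacobi' g (c 0) (w 0) *m g (c 0) = g (c 0) *m (jacobi' g (c 0) (w 0))^T.
  apply: (cov_derive_selfadjoint Uo gsm metric_unit metric_tr (Uc 0 it) (dc 0 te it) dJ).
  by apply: filterS first_order => s [].
have kJ' : w 0 *m jacobi' g (c 0) (w 0) = 0.
  apply: (cov_derive_kernel (dw 0 te it) dJ).
  by apply: filterS first_order => s [].
(* The second derivative of tr(u^2) = - ric, at time 0. *)
have uJ' : 2 * \tr (ui 0 *m jacobi' g (c 0) (w 0)) = D2 g (c 0) (w 0).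
  have d3 := cov_derive_mxtrace (cov_derive_mul (du 0 te it) dJ).
  have d4 : is_derive (0 : R) 1 (fun s => 2 * \tr (ui s *m J s))
      (2 * \tr (B 0 *m J 0 + ui 0 *m jacobi' g (c 0) (w 0))) by exact: is_deriveZ.
  have := is_derive_unique (near_eq_is_derive second_order d4)
    (is_derive_D1 Uo gsm metric_unit (Uc 0 it) (dc 0 te it) (dw 0 te it)).
  have uV := sub_perp _ _ it su_0 ku_0; have JV := sub_perp _ _ it sJ kJ.
  have u2J : \tr (ui 0 *m ui 0 *m J 0) = 2^-1 * \tr (ui 0 *m ui 0) * \tr (J 0).
    have w00 := nbhs_singleton w0.
    have r2 := rank_perp_tangent (Uc 0 it) w00.
    by rewrite (mxtrace_square_mul r2 (row_base_free _) uV JV tu_0).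
  rewrite /D2 => <-; rewrite /B mulmxBl mulNmx !linearD !linearN /= u2J uu.
  by rewrite -/(J 0) /endo_comp -mxtrace_jacobi -/(J 0); field.
have <- : c 0 = chart i p by rewrite /c /curve_coord g0.
rewrite -v0; exists (ui 0); split; split=> //; exact: nbhs_singleton second_order.
Unshelve. all: by end_near. Qed.

Lemma exists_riccati_algebra X : X != 0 -> exists u, riccati_algebra g (chart i p) X u.
Proof.
move=> X0; set x := chart i p; pose a := Num.sqrt (bilin (g x) X X).
have b0 : 0 < bilin (g x) X X by exact: metric_pos.
have a0 : a != 0 by rewrite gt_eqF ?sqrtr_gt0.
have [|u Hu] := @unit_riccati_algebra (a^-1 *: X).
  by rewrite bilinZ exprVn sqr_sqrtr ?(ltW b0) // mulVf ?gt_eqF.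
by exists (a *: u); have := riccati_algebraZ a Hu; rewrite scalerA divff // scale1r.
Qed.

Lemma jacobi_sub_perp X u : riccati_algebra g (chart i p) X u ->
  let V := row_base (kermx (g (chart i p) *m X^T)) in
  [/\ (u <= V)%MS, (jacobi g (chart i p) X <= V)%MS & (jacobi' g (chart i p) X <= V)%MS].
Proof.
by move=> [[su sJ sJ'] [ku kJ kJ'] _]; split; exact: selfadjoint_sub_perp.
Qed.

Lemma gram_identity X : X != 0 ->
  PP g (chart i p) X ^+ 2 = DD g (chart i p) X * (- D1 g (chart i p) X ^+ 2
    - 4 * \tr (endo_comp (Jo g (chart i p) X) (Jo g (chart i p) X))
      * bilin (ricci g (chart i p)) X X).
Proof.
move=> X0; have Ux : U (chart i p) by exists p.
have [u Hu] := exists_riccati_algebra X0; have sub := jacobi_sub_perp Hu.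
have [[su sJ sJ'] _ [u0 uu uJ uJ']] := Hu; rewrite -mxtrace_jacobi.
apply: (restricted_gram_square (rank_perp_tangent Ux X0) (row_base_free _) _
  (And3 su sJ sJ') sub u0 uu uJ uJ') => v v0.
by rewrite gt_eqF //; exact: metric_pos.
Qed.

Lemma PP_polyE X : PP g (chart i p) X = PP_poly g (chart i p) X.
Proof.
have [->|X0] := eqVneq X 0.
  by rewrite PP0 /PP_poly jacobi0 !(mulmx0, mxtrace0, mulr0, mul0r, subrr).
have Ux : U (chart i p) by exists p.
have [u Hu] := exists_riccati_algebra X0; have [_ JV J'V] := jacobi_sub_perp Hu.
have r2 := rank_perp_tangent Ux X0.
congr (_ * _ - _ * _); exact: (mxtrace_tracefree_conjmx r2 (row_base_free _)).
Qed.

End Manifold.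

Theorem theorem3p1 (R : realType) (M : riemannian_manifold R 3) :
  has_tracefree_riccati_solutions M ->
  forall (p : M) (i : chart_index M), dom i p ->
    let g := metric i in
    let x := chart i p in
    (forall X : 'rV[R]_3,
       PP g x X ^+ 2 =
       DD g x X *
         (- D1 g x X ^+ 2
          - 4 * \tr (endo_comp (Jo g x X) (Jo g x X)) * bilin (ricci g x) X X))
    /\ (exists2 d : nat, (d <= 8)%N & homogeneous_polynomial d (PP g x)).
Proof.
move=> hM p i ip g x; split=> [X|]; last first.
  exists 8%N => //; apply: homogeneous_eq (homogeneous_PP_poly g x) => X.
  by rewrite -PP_polyE.
have [->|X0] := eqVneq X 0; last exact: gram_identity.
have D10 : D1 g x 0 = 0 by rewrite -[in LHS](scale0r 0) D1Z expr0n mul0r.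
by rewrite PP0 D10 /endo_comp Jo0 mul0mx mxtrace0 expr0n /= !(mulr0, mul0r, oppr0, addr0).
Qed.
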